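(* For any weighted grid of width $\omega$ there exists another weighted grid of the same width $\omega$ and of depth at most $\frac{\omega^5}{4}$ such that the distances between vertices in the first row of the original grid are preserved; that is, for all $1\le i\le j\le\omega$, the distance between the $i$-th and the $j$-th vertex of the first row is the same in the two grids.
   Context: A grid of width $\omega$ and depth (length) $\ell$ is the complete grid graph with $\ell$ rows of $\omega$ vertices each, with edges exactly between horizontally or vertically adjacent vertices. A weighted grid carries a non-negative weight on every edge. The distance between two vertices is the minimum total weight of a path between them within the given grid.
   Formalization: The width ω is assumed to be at least 2; for ω = 1 the bound ω^5/4 = 1/4 is less than 1, while any grid with a first row has depth at least 1, so the claim fails there. *)

(* Defs.v *)
From mathcomp Require Import all_boot all_order all_algebra.
Set Implicit Arguments.
Unset Strict Implicit.
Unset Printing Implicit Defensive.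
Import Order.TTheory GRing.Theory Num.Theory.
Local Open Scope ring_scope.

(* The vertex (r, c) lies in row r and column c; rows and columns are counted
   from 0, so the first row is row 0. *)
Definition grid_vertex (depth width : nat) : finType := ('I_depth * 'I_width)%type.

Definition grid_adj (depth width : nat) : rel (grid_vertex depth width) :=
  fun u v =>
    ((u.1 == v.1) && ((u.2.+1 == v.2 :> nat) || (v.2.+1 == u.2 :> nat)))
 || ((u.2 == v.2) && ((u.1.+1 == v.1 :> nat) || (v.1.+1 == u.1 :> nat))).

(* Edges are undirected, hence the symmetry; the values of [weight] on
   non-adjacent pairs are never used. *)
Record weighted_grid (R : realFieldType) (depth width : nat) := WeightedGrid {
  weight :> grid_vertex depth width -> grid_vertex depth width -> R;
  weight_sym : forall u v, weight u v = weight v u;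
  weight_ge0 : forall u v, grid_adj u v -> 0 <= weight u v
}.

(* The path is u :: p, with no repeated vertex; p may be empty. *)
Definition grid_path (depth width : nat) (u v : grid_vertex depth width)
    (p : seq (grid_vertex depth width)) : bool :=
  [&& path (@grid_adj depth width) u p, uniq (u :: p) & last u p == v].

Definition path_weight (R : realFieldType) (depth width : nat)
    (G : weighted_grid R depth width) (u : grid_vertex depth width)
    (p : seq (grid_vertex depth width)) : R :=
  \sum_(e <- zip (u :: p) p) G e.1 e.2.

Definition is_dist (R : realFieldType) (depth width : nat)
    (G : weighted_grid R depth width) (u v : grid_vertex depth width) (d : R) : Prop :=
  (exists2 p, grid_path u v p & path_weight G u p = d) /\
  (forall p, grid_path u v p -> d <= path_weight G u p).

(* A grid has a first row only if its depth is positive, whence the successor. *)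
Definition first_row (depth' width : nat) (i : 'I_width) :
  grid_vertex depth'.+1 width := (ord0, i).

(* Main.v *)
Require Import Defs.
From mathcomp Require Import all_boot all_order all_algebra.
From mathcomp Require Import zify lra.
From Stdlib Require Import FunctionalExtensionality.
Set Implicit Arguments.
Unset Strict Implicit.
Unset Printing Implicit Defensive.
Import Order.TTheory GRing.Theory Num.Theory.
Local Open Scope ring_scope.

(* Record the distances within the rows of index at least r between the vertices
   of row r as a pseudometric on column indices.  Passing from row r + 1 to row r
   applies "spikes" (lengthen all distances to one column: a vertical edge) and
   then "shunts" (add an edge between two consecutive columns).  Number the spike
   at column i by 2i and the shunt between columns i and i + 1 by 2i + 1.  These
   operations satisfy the relations of the symmetric group on 2 omega letters up to
   a change of the weights: far apart ones commute, equal consecutive ones merge,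
   and the braid relation is the star-triangle transformation.  As each operation
   can also be made trivial by a suitable weight, any sequence of operations is
   equivalent to one along the staircase word of the longest permutation, which has
   omega (2 omega - 1) letters.  Every letter is realized by one row, over a last
   row of weight 0, and omega (2 omega - 1) + 1 <= omega^5 / 4. *)

(** * Spikes and shunts acting on pseudometrics *)

Section Operations.
Variable R : realFieldType.
Implicit Types (d e : nat -> nat -> R) (a b w p q r : R).

Definition pseudometric d :=
  [/\ forall j, d j j = 0, forall j k, d j k = d k j
    & forall j m k, d j k <= d j m + d m k].

Lemma eq_dist d e : (forall j k, d j k = e j k) -> d = e.
Proof. by move=> de; do 2![apply: functional_extensionality => ?]. Qed.

Lemma pseudometric_ge0 d j k : pseudometric d -> 0 <= d j k.
Proof.
by case=> d0 dC dD; have := dD j k j; rewrite d0 (dC k j); lra.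
Qed.

Lemma pseudometricC d j k : pseudometric d -> d j k = d k j.
Proof. by case. Qed.

(** The diagonal is set apart so that the distance from [x] to itself stays 0 instead of growing by
    [a + a]. *)
Definition spike (x : nat) a d (j k : nat) : R :=
  if j == k then d j k
  else d j k + (if j == x then a else 0) + (if k == x then a else 0).

(** A shortest path crosses the new edge at most once, in one of two directions: hence three
    candidates. *)
Definition shunt (x y : nat) w d (j k : nat) : R :=
  Num.min (d j k) (Num.min (d j x + w + d y k) (d j y + w + d x k)).

Lemma min_spec (a b : R) :
  [/\ Num.min a b <= a, Num.min a b <= b & Num.min a b = a \/ Num.min a b = b].
Proof. by rewrite /Num.min; case: ltP => h; split; lra. Qed.

Lemma shuntP x y w d j k :
  [/\ shunt x y w d j k <= d j k,
      shunt x y w d j k <= d j x + w + d y k,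
      shunt x y w d j k <= d j y + w + d x k
    & [\/ shunt x y w d j k = d j k,
          shunt x y w d j k = d j x + w + d y k
        | shunt x y w d j k = d j y + w + d x k]].
Proof.
rewrite /shunt; set u := d j x + w + _; set v := d j y + w + _.
have [h1 h2 h3] := min_spec u v; have [h4 h5 h6] := min_spec (d j k) (Num.min u v).
split; [lra|lra|lra|].
by case: h6 => ->; [constructor 1|case: h3 => ->; [constructor 2|constructor 3]].
Qed.

Lemma pseudometric_spike x a d :
  0 <= a -> pseudometric d -> pseudometric (spike x a d).
Proof.
move=> a0 dpm; have dge0 j k := pseudometric_ge0 j k dpm.
case: dpm => d0 dC dD; split=> [j|j k|j m k]; rewrite /spike.
- by rewrite eqxx.
- by rewrite (eq_sym k j) (dC k j); case: ifP => // _; lra.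
- have := dD j m k; have := dge0 j m; have := dge0 m k.
  have [<-|jk] := eqVneq j k.
    by rewrite ?eqxx d0 (dC m j); do ?case: ifP => ?; lra.
  have [<-|jm] := eqVneq j m; first by rewrite ?eqxx (negPf jk) d0; lra.
  by have [->|mk] := eqVneq m k; rewrite ?eqxx ?d0; do ?case: ifP => ?; lra.
Qed.

(** In the triangle inequality, two legs that both use the new edge can be shortcut so as to use it
    at most once. *)
Lemma pseudometric_shunt x y w d :
  0 <= w -> pseudometric d -> pseudometric (shunt x y w d).
Proof.
move=> w0 dpm; have dge0 j k := pseudometric_ge0 j k dpm.
case: dpm => d0 dC dD; split=> [j|j k|j m k].
- have [h1 _ _ h] := shuntP x y w d j j; rewrite d0 in h1 h.
  have := dge0 j x; have := dge0 j y; have := dge0 x j; have := dge0 y j.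
  by case: h; lra.
- rewrite /shunt (dC k j) (dC k x) (dC k y) (dC j x) (dC j y).
  rewrite [Num.min (d x k + _ + _) _]minC; congr (Num.min _ (Num.min _ _)); lra.
- have [h1 h2 h3 _] := shuntP x y w d j k.
  have [_ _ _ hl] := shuntP x y w d j m; have [_ _ _ hr] := shuntP x y w d m k.
  have := dD j m k; have := dD j m x; have := dD j m y.
  have := dD x m k; have := dD y m k.
  have := dD j x k; have := dD j y k.
  have := dge0 y m; have := dge0 x m; have := dge0 m k; have := dge0 j m.
  have := dge0 j x; have := dge0 j y; have := dge0 x k; have := dge0 y k.
  rewrite (dC m x) (dC m y) in hr *.
  by case: hl => ->; case: hr => ->; lra.
Qed.

Lemma shunt_le x y w d j k : shunt x y w d j k <= d j k.
Proof. by case: (shuntP x y w d j k). Qed.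

Lemma shunt_le_weight x y w d : pseudometric d -> shunt x y w d x y <= w.
Proof. by case=> d0 _ _; case: (shuntP x y w d x y) => _; rewrite !d0; lra. Qed.

(** With [shunt_le] and [shunt_le_weight] this makes the shunt the greatest pseudometric below [d]
    whose value at [x], [y] is at most [w]. Identities between shunts follow from this
    characterization by antisymmetry. *)
Lemma shunt_max x y w d e :
  pseudometric e -> (forall j k, e j k <= d j k) -> e x y <= w ->
  forall j k, e j k <= shunt x y w d j k.
Proof.
case=> e0 eC eD led exy j k.
have [_ _ _ h] := shuntP x y w d j k.
have := eD j x k; have := eD x y k; have := eD j y k; have := eD y x k.
have := led j k; have := led j x; have := led y k; have := led j y; have := led x k.
by rewrite (eC y x); case: h => ->; lra.
Qed.

Lemma shuntC x y w d : shunt x y w d = shunt y x w d.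
Proof.
by apply: eq_dist => j k; rewrite /shunt [X in Num.min _ X]minC.
Qed.

Lemma le_dist_anti d e : (forall j k, d j k <= e j k) -> (forall j k, e j k <= d j k) -> d = e.
Proof.
move=> le ge; apply: eq_dist => j k.
by apply/eqP; rewrite eq_le le ge.
Qed.

Lemma spike0 x d : spike x 0 d = d.
Proof.
by apply: eq_dist => j k; rewrite /spike; do 3?case: ifP; lra.
Qed.

Lemma shunt_id x y w d : pseudometric d -> d x y <= w -> shunt x y w d = d.
Proof.
move=> dpm dxy; apply: le_dist_anti => j k; first exact: shunt_le.
exact: shunt_max.
Qed.

Lemma spike_spike x a b d : spike x b (spike x a d) = spike x (a + b) d.
Proof.
apply: eq_dist => j k; rewrite /spike.
by do ?case: ifP; lra.
Qed.

Lemma spike_comm x y a b d : spike x b (spike y a d) = spike y a (spike x b d).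
Proof. by apply: eq_dist => j k; rewrite /spike; case: (j == k); lra. Qed.

Lemma shunt_comm_le x y z t a b d :
  0 <= a -> 0 <= b -> pseudometric d -> forall j k,
  shunt x y b (shunt z t a d) j k <= shunt z t a (shunt x y b d) j k.
Proof.
move=> a0 b0 dpm; have d1 := pseudometric_shunt z t a0 dpm.
apply: shunt_max; first exact: pseudometric_shunt.
- apply: shunt_max; first exact: pseudometric_shunt.
    by move=> j k; apply: le_trans (shunt_le _ _ _ _ _ _) (shunt_le _ _ _ _ _ _).
  exact: shunt_le_weight.
- apply: le_trans (shunt_le _ _ _ _ _ _) _; exact: shunt_le_weight.
Qed.

Lemma shunt_comm x y z t a b d : 0 <= a -> 0 <= b -> pseudometric d ->
  shunt x y b (shunt z t a d) = shunt z t a (shunt x y b d).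
Proof. by move=> *; apply: le_dist_anti => j k; apply: shunt_comm_le. Qed.

Lemma shunt_shunt x y a b d : 0 <= a -> 0 <= b -> pseudometric d ->
  shunt x y b (shunt x y a d) = shunt x y (Num.min a b) d.
Proof.
move=> a0 b0 dpm; have ab0 : 0 <= Num.min a b by rewrite le_min a0.
have d1 := pseudometric_shunt x y a0 dpm.
have d2 := pseudometric_shunt x y b0 d1.
have d3 := pseudometric_shunt x y ab0 dpm.
have [m1 m2 _] := min_spec a b.
have h3 := shunt_le_weight x y (Num.min a b) dpm.
apply: le_dist_anti; apply: shunt_max => //.
- by move=> j k; apply: le_trans (shunt_le _ _ _ _ _ _) (shunt_le _ _ _ _ _ _).
- rewrite le_min shunt_le_weight // andbT.
  by apply: le_trans (shunt_le _ _ _ _ _ _) _; apply: shunt_le_weight.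
- by apply: shunt_max => //; [move=> j k; exact: shunt_le|lra].
- lra.
Qed.

Lemma spike_col x a d j y : x != y ->
  spike x a d j y = d j y + (if j == x then a else 0).
Proof.
move=> xy; rewrite /spike (eq_sym y x) (negPf xy) addr0.
by case: eqVneq => // ->; rewrite (eq_sym y x) (negPf xy) addr0.
Qed.

Lemma spike_row x a d y k : x != y ->
  spike x a d y k = d y k + (if k == x then a else 0).
Proof.
move=> xy; rewrite /spike (eq_sym y x) (negPf xy) addr0.
by case: eqVneq => // <-; rewrite (eq_sym y x) (negPf xy) addr0.
Qed.

(** Off the diagonal, a spike away from both ends of the shunt adds the same amount to all three
    candidates of the minimum. *)
Lemma spike_shunt_comm x y z a w d : x != y -> x != z ->
  0 <= a -> 0 <= w -> pseudometric d ->
  spike x a (shunt y z w d) = shunt y z w (spike x a d).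
Proof.
move=> xy xz a0 w0 dpm; have d1 := pseudometric_shunt y z w0 dpm.
have d2 := pseudometric_spike x a0 dpm.
have d3 := pseudometric_shunt y z w0 d2.
apply: eq_dist => j k; have [<-|jk] := eqVneq j k.
  by case: d3 => -> _ _; rewrite /spike eqxx; case: d1 => ->.
rewrite [LHS]/spike (negPf jk) /shunt !(spike_col _ _ _ xy) !(spike_col _ _ _ xz).
rewrite !(spike_row _ _ _ xy) !(spike_row _ _ _ xz) /spike (negPf jk).
move: (if j == x then _ else _) (if k == x then _ else _) => s t.
by rewrite -addrA !addr_minl; congr (Num.min _ (Num.min _ _)); lra.
Qed.

Lemma shunt_colx x y w d j : pseudometric d -> 0 <= w ->
  shunt x y w d j x = Num.min (d j x) (d j y + w).
Proof.
move=> dpm w0; have dxy0 := pseudometric_ge0 x y dpm; case: dpm => d0 dC _.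
have [h1 _ h3 h] := shuntP x y w d j x; rewrite d0 in h3 h; rewrite (dC y x) in h.
have [? ? h'] := min_spec (d j x) (d j y + w).
by apply/eqP; rewrite eq_le; apply/andP; split;
  [case: h' => ->|case: h => ->]; lra.
Qed.

Lemma shunt_coly x y w d j : pseudometric d -> 0 <= w ->
  shunt x y w d j y = Num.min (d j y) (d j x + w).
Proof. by move=> *; rewrite shuntC shunt_colx. Qed.

(* Y-Delta: with the new and the old copy of [x] and with [y], the three
   operations on the left span a triangle with sides [p], [q], [r], those on the
   right a star with legs [a], [b], [w]. *)
Lemma triangle_star x y p q r a b w d :
  x != y -> pseudometric d ->
  0 <= p -> 0 <= q -> 0 <= r -> 0 <= a -> 0 <= b -> 0 <= w ->
  b + w = Num.min p (q + r) -> a + b = Num.min q (p + r) ->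
  a + w = Num.min r (p + q) ->
  shunt x y r (spike x q (shunt x y p d)) =
  spike x a (shunt x y w (spike x b d)).
Proof.
move=> xy dpm p0 q0 r0 a0 b0 w0 eP eQ eR.
have d1 := pseudometric_shunt x y p0 dpm.
have d2 := pseudometric_spike x q0 d1.
have d3 := pseudometric_shunt x y r0 d2.
have e1 := pseudometric_spike x b0 dpm.
have e2 := pseudometric_shunt x y w0 e1.
have e3 := pseudometric_spike x a0 e2.
have [P1 P2 hP] := min_spec p (q + r); have [Q1 Q2 hQ] := min_spec q (p + r).
have [R1 R2 hR] := min_spec r (p + q).
rewrite -eP in P1 P2 hP; rewrite -eQ in Q1 Q2 hQ; rewrite -eR in R1 R2 hR.
clear eP eQ eR.
(* Pairs involving [x] come first: there the path ends at the new copy of [x], one of the three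
   terminals of the star and of the triangle. *)
have colx j : j != x -> shunt x y r (spike x q (shunt x y p d)) j x =
              spike x a (shunt x y w (spike x b d)) j x.
  move=> jx; have xj : x != j by rewrite eq_sym.
  rewrite shunt_colx // (spike_col _ _ _ xy) (spike_row _ _ _ xj) eqxx (negPf jx).
  rewrite (spike_row _ _ _ xj) eqxx shunt_colx // shunt_coly // shunt_colx //.
  rewrite (spike_col _ _ _ xy) (spike_row _ _ _ xj) eqxx (negPf jx) !addr0.
  have := min_spec (d j x) (d j y + p); have := min_spec (d j y) (d j x + p).
  move: (Num.min _ (d j y + p)) (Num.min _ (d j x + p)) => m1 m2 [? ? h2] [? ? h1].
  have [? ? h3] := min_spec (m1 + q) (m2 + r).
  have [? ? h4] := min_spec (d j x + b) (d j y + w).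
  clear dpm d1 d2 d3 e1 e2 e3.
  apply/eqP; rewrite eq_le; apply/andP; split.
    by case: h4 => ->; case: hR => ?; case: hQ => ?; lra.
  by case: h3 => ->; case: h1 => ?; case: h2 => ?; lra.
apply: eq_dist => j k.
have [->|kx] := eqVneq k x; have [->|jx] := eqVneq j x.
- by case: d3 => -> _ _; case: e3 => ->.
- exact: colx.
- by case: d3 => _ -> _; case: e3 => _ -> _; exact: colx.
have xj : x != j by rewrite eq_sym.
have xk : x != k by rewrite eq_sym.
have spike_off a' f : spike x a' f j k = f j k.
  by rewrite /spike (negPf kx) (negPf jx) !addr0 if_same.
(* Between columns other than [x], a path using the added edge must also cross the spike, so the two
   act as a single shunt of weight [a' + p']. *)
have shunt_off p' a' f : shunt x y p' (spike x a' f) j k =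
    Num.min (f j k) (Num.min (f j x + (a' + p') + f y k) (f j y + (a' + p') + f x k)).
  rewrite /shunt spike_off !(spike_row _ _ _ xj) !(spike_col _ _ _ xk).
  rewrite eqxx (eq_sym y x) (negPf xy) !addr0.
  congr (Num.min _ (Num.min _ _)); lra.
have p1 := shuntP x y p d j k.
rewrite spike_off !shunt_off (shunt_colx _ _ _ dpm) // (shunt_coly _ _ _ dpm) //.
have -> : shunt x y p d y k = Num.min (d y k) (d x k + p).
  by case: d1 => _ -> _; rewrite shunt_coly // !(pseudometricC k _ dpm).
have -> : shunt x y p d x k = Num.min (d x k) (d y k + p).
  by case: d1 => _ -> _; rewrite shunt_colx // !(pseudometricC k _ dpm).
have tx : d j k <= d j x + d x k by case: dpm.
have ty : d j k <= d j y + d y k by case: dpm.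
have := min_spec (d j x + (b + w) + d y k) (d j y + (b + w) + d x k).
move: (Num.min (d j x + (b + w) + d y k) _) => m6 [m61 m62 h6].
have := min_spec (d j k) m6; move: (Num.min _ m6) => m8 [m81 m82 h8].
move: p1; move: (shunt x y p d j k) => D [D1 D2 D3 hD].
have := min_spec (d j x) (d j y + p); have := min_spec (d j y) (d j x + p).
move: (Num.min _ (d j y + p)) (Num.min _ (d j x + p)) => m1 m2 [l21 l22 h2] [l11 l12 h1].
have := min_spec (d x k) (d y k + p); have := min_spec (d y k) (d x k + p).
move: (Num.min _ (d y k + p)) (Num.min _ (d x k + p)) => m3 m4 [l41 l42 h4] [l31 l32 h3].
have := min_spec (m1 + (q + r) + m4) (m2 + (q + r) + m3).
move: (Num.min (m1 + (q + r) + m4) _) => m5 [m51 m52 h5].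
have := min_spec D m5; move: (Num.min D m5) => m7 [m71 m72 h7].
clear hQ hR dpm d1 d2 d3 e1 e2 e3 a0 b0 w0.
apply/eqP; rewrite eq_le; apply/andP; split.
  clear h1 h2 h3 h4 h5 h7 hD tx ty.
  case: h8 => ->; first lra.
  by case: h6 => ->; case: hP => ?; lra.
have m6x : m8 <= d j x + (q + r) + d y k by lra.
have m6y : m8 <= d j y + (q + r) + d x k by lra.
case: h7 => ->; first by case: hD => ->; lra.
clear h6 h8 hP hD m71 m72 m51 m52 D1 D2 D3 m61 m62 m82.
clear l21 l22 l11 l12 l41 l42 l31 l32.
by case: h5 => ->; [case: h1 => ->; case: h4 => ->|case: h2 => ->; case: h3 => ->]; lra.
Qed.
End Operations.

(** * Words of operations and the relations between them *)

Section Words.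
Variable R : realFieldType.
Implicit Types (d e f : nat -> nat -> R) (a b : R) (g i k m : nat) (w : seq nat).

Definition op g a d := if odd g then shunt g./2 g./2.+1 a d else spike g./2 a d.

Lemma pseudometric_op g a d : 0 <= a -> pseudometric d -> pseudometric (op g a d).
Proof.
by rewrite /op; case: ifP => _; [exact: pseudometric_shunt|exact: pseudometric_spike].
Qed.

(* The head of the word is applied first, i.e. it is the lowest row of the grid. *)
Fixpoint reach w d e : Prop :=
  if w is g :: w' then exists2 a, 0 <= a & reach w' (op g a d) e else e = d.

Lemma pseudometric_reach w d e : pseudometric d -> reach w d e -> pseudometric e.
Proof.
elim: w d => [|g w IHw] d dpm /=; first by move->.
by case=> a a0; apply: IHw; apply: pseudometric_op.
Qed.

Lemma reach_cat w1 w2 d e :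
  reach (w1 ++ w2) d e <-> exists2 f, reach w1 d f & reach w2 f e.
Proof.
elim: w1 d => [|g w IHw] d /=.
  by split=> [?|[f -> //]]; exists d.
split=> [[a a0 /IHw[f wf fe]]|[f [a a0 wf] fe]]; first by exists f => //; exists a.
by exists a => //; apply/IHw; exists f.
Qed.

(** The relation is semantic: [w2] can achieve whatever [w1] achieves, with weights chosen afresh.
    It is restricted to pseudometrics, for which the identities above are proved. *)
Definition subword w1 w2 :=
  forall d e, pseudometric d -> reach w1 d e -> reach w2 d e.

Lemma subword_trans w2 w1 w3 : subword w1 w2 -> subword w2 w3 -> subword w1 w3.
Proof. by move=> w12 w23 d e dpm /w12-/(_ dpm)/w23; apply. Qed.

Lemma subword_cat w1 w2 w1' w2' :
  subword w1 w1' -> subword w2 w2' -> subword (w1 ++ w2) (w1' ++ w2').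
Proof.
move=> s1 s2 d e dpm /reach_cat[f df fe]; apply/reach_cat.
exists f; first exact: s1.
by apply: s2 => //; apply: pseudometric_reach df.
Qed.

Lemma subword_refl w : subword w w.
Proof. by []. Qed.

(** The neutral weight is 0 for a spike and the current distance of the two columns for a shunt. *)
Lemma subword_nil g : subword [::] [:: g].
Proof.
move=> d e dpm /= ->; case: (boolP (odd g)) => og; rewrite /op.
  exists (d g./2 g./2.+1); first exact: pseudometric_ge0.
  by rewrite og shunt_id.
by exists 0; rewrite // (negPf og) spike0.
Qed.

(** Edges in series add their weights; of parallel edges the lighter one counts. *)
Lemma subword_merge g : subword [:: g; g] [:: g].
Proof.
move=> d e dpm /= [a a0 [b b0 ->]]; rewrite /op; case: (odd g).
  by exists (Num.min a b); rewrite ?le_min ?a0 ?b0 // shunt_shunt.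
by exists (a + b); rewrite ?addr_ge0 // spike_spike.
Qed.

(** Two spikes or two shunts always commute; for a spike and a shunt, the gap says that the spike is
    at neither end of the shunt. *)
Lemma subword_comm g k :
  (k.+1 < g)%N || (g.+1 < k)%N -> subword [:: g; k] [:: k; g].
Proof.
move=> kg d e dpm /= [a a0 [b b0 ->]]; exists b => //; exists a => //.
rewrite /op; case og: (odd g); case ok: (odd k).
- by rewrite shunt_comm.
- by rewrite spike_shunt_comm //; lia.
- by rewrite -spike_shunt_comm //; lia.
- by rewrite spike_comm.
Qed.

(** The sides are the pairwise sums of the legs; they satisfy the triangle inequalities, so each
    minimum in [triangle_star] is its first argument. *)
Lemma star_to_triangle x y a b p d : x != y -> pseudometric d ->
  0 <= a -> 0 <= b -> 0 <= p ->
  spike x b (shunt x y p (spike x a d)) =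
  shunt x y (b + p) (spike x (a + b) (shunt x y (a + p) d)).
Proof.
move=> xy dpm a0 b0 p0; apply/esym/triangle_star => //; try lra.
all: by rewrite min_l; lra.
Qed.

Lemma triangle_to_star x y p q r d : x != y -> pseudometric d ->
  0 <= p -> 0 <= q -> 0 <= r -> exists a b c, [/\ 0 <= a, 0 <= b, 0 <= c &
  shunt x y r (spike x q (shunt x y p d)) = spike x a (shunt x y c (spike x b d))].
Proof.
move=> xy dpm p0 q0 r0.
have [P1 P2 hP] := min_spec p (q + r); have [Q1 Q2 hQ] := min_spec q (p + r).
have [R1 R2 hR] := min_spec r (p + q).
(* Replacing each side by the shortest connection of its ends enforces the triangle inequalities;
   the legs are then the Gromov products, which are non-negative. *)
pose P := Num.min p (q + r); pose Q := Num.min q (p + r); pose S := Num.min r (p + q).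
exists ((Q + S - P) / 2), ((P + Q - S) / 2), ((P + S - Q) / 2).
have a0 : 0 <= (Q + S - P) / 2 by rewrite /P /Q /S; case: hQ => ->; case: hR => ->; lra.
have b0 : 0 <= (P + Q - S) / 2 by rewrite /P /Q /S; case: hQ => ->; case: hP => ->; lra.
have c0 : 0 <= (P + S - Q) / 2 by rewrite /P /Q /S; case: hP => ->; case: hR => ->; lra.
by split=> //; apply: triangle_star => //; rewrite -?/P -?/Q -?/S; lra.
Qed.

(** For odd [g] the left word is a star, with two spikes at the right end of a shunt; for even [g]
    it is a triangle, with a spike at the left end of two shunts. *)
Lemma subword_braid g : subword [:: g.+1; g; g.+1] [:: g; g.+1; g].
Proof.
move=> d e dpm /= [a a0 [b b0 [c c0 ->]]]; rewrite /op /= uphalf_half.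
case: (odd g); rewrite /= ?add1n ?add0n.
  exists (a + b); first exact: addr_ge0.
  exists (a + c); first exact: addr_ge0.
  exists (c + b); first exact: addr_ge0.
  by rewrite !(shuntC g./2) star_to_triangle //; lia.
have xy : g./2 != g./2.+1 by lia.
have [a' [b' [c' [a'0 b'0 c'0 ->]]]] := triangle_to_star xy dpm a0 b0 c0.
by exists b' => //; exists c' => //; exists a'.
Qed.

(** * Reduction of all words to the staircase word *)

Fixpoint descent k := if k is k'.+1 then k' :: descent k' else [::].

(** This is a reduced word of the longest permutation of [k + 1] letters. *)
Fixpoint staircase k := if k is k'.+1 then staircase k' ++ descent k'.+1 else [::].

Lemma size_staircase k : size (staircase k) = 'C(k.+1, 2).
Proof.
elim: k => // k IHk; rewrite binS bin1 -IHk /= size_cat /=; congr (_ + _.+1)%N.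
by elim: k {IHk} => //= k ->.
Qed.

Lemma subword_cons g w1 w2 : subword w1 w2 -> subword (g :: w1) (g :: w2).
Proof. by move=> s12; apply: (@subword_cat [:: g] _ [:: g]). Qed.

Lemma subword_descent_comm k g :
  (k < g)%N -> subword (descent k ++ [:: g]) (g :: descent k).
Proof.
elim: k => [_|k IHk kg] //=.
apply: (@subword_trans (k :: g :: descent k)).
  by apply: subword_cons; apply: IHk; lia.
by apply: (@subword_cat [:: k; g] _ [:: g; k]) => //; apply: subword_comm; rewrite kg orbT.
Qed.

(** Moving left, [i + 1] commutes with the letters below [i], becomes [i] by the braid relation at
    [i + 1, i], and then commutes with the larger letters. *)
Lemma subword_descent_shift k i :
  (i.+1 < k)%N -> subword (descent k ++ [:: i.+1]) (i :: descent k).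
Proof.
elim: k => [//|k IHk]; rewrite ltnS leq_eqVlt => /orP[/eqP <-|ik] /=.
  apply: (@subword_trans [:: i.+1, i, i.+1 & descent i]).
    by do 2!apply: subword_cons; apply: subword_descent_comm.
  by apply: (@subword_cat [:: i.+1; i; i.+1] _ [:: i; i.+1; i]) => //; apply: subword_braid.
apply: (@subword_trans [:: k, i & descent k]); first by apply: subword_cons; exact: IHk.
by apply: (@subword_cat [:: k; i] _ [:: i; k]) => //; apply: subword_comm; rewrite ik.
Qed.

Lemma subword_descent_merge k : subword (descent k.+1 ++ [:: 0%N]) (descent k.+1).
Proof. by elim: k => [|k IHk]; [exact: subword_merge|exact: subword_cons]. Qed.

(** The longest element absorbs every generator. The letter 0 merges with the end of the last
    descent; [i + 1] crosses that descent, becoming [i], and is absorbed by the shorter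
    staircase. *)
Lemma subword_staircase_rcons k i :
  (i < k)%N -> subword (staircase k ++ [:: i]) (staircase k).
Proof.
elim: k i => [//|k IHk] [_|i ik] /=; rewrite -catA.
  exact: subword_cat (@subword_refl _) (@subword_descent_merge k).
apply: (@subword_trans ((staircase k ++ [:: i]) ++ descent k.+1)).
  rewrite -catA; exact: subword_cat (@subword_refl _) (@subword_descent_shift k.+1 i ik).
exact: subword_cat (IHk i ik) (@subword_refl _).
Qed.

Lemma subword_nilw w : subword [::] w.
Proof. elim: w => // g w IHw; exact: (@subword_cat [::] [::] [:: g] w (@subword_nil g)). Qed.

Lemma subword_staircase k w : all (fun i => i < k)%N w -> subword w (staircase k).
Proof.
elim/last_ind: w => [_|w i IHw]; first exact: subword_nilw.
rewrite all_rcons -cats1 => /andP[ik /IHw wk].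
apply: (@subword_trans (staircase k ++ [:: i])); first exact: subword_cat.
exact: subword_staircase_rcons.
Qed.
End Words.

(** * One row of a grid as a sequence of operations, and one operation as a row *)

Section Rows.
Variable R : realFieldType.
Implicit Types (d e : nat -> nat -> R) (v h : nat -> R) (a : R) (g m n : nat).

Fixpoint spikes v m d := if m is k.+1 then spike k (v k) (spikes v k d) else d.

Fixpoint shunts h m d := if m is k.+1 then shunt k k.+1 (h k) (shunts h k d) else d.

(** Here [n] is the last column index: [n + 1] vertical edges lead up to the row, which has [n]
    horizontal edges. *)
Definition rowop n v h d := shunts h n (spikes v n.+1 d).

Lemma spikesE v m d j k : pseudometric d -> spikes v m d j k =
  if j == k then 0 else
  d j k + (if (j < m)%N then v j else 0) + (if (k < m)%N then v k else 0).
Proof.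
move=> dpm; elim: m => [|m IHm] /=.
  by case: eqVneq => [->|_]; [case: dpm|rewrite !addr0].
rewrite /spike IHm; case: eqVneq => // jk; rewrite !ltnS (leq_eqVlt j m) (leq_eqVlt k m).
case: (eqVneq j m) => [jm|_]; case: (eqVneq k m) => [km|_] /=; try subst j; try subst k;
  rewrite ?eqxx ?ltnn in jk *; lra.
Qed.

Lemma pseudometric_spikes v m d :
  (forall k, 0 <= v k) -> pseudometric d -> pseudometric (spikes v m d).
Proof. by move=> v0 dpm; elim: m => //= m; apply: pseudometric_spike. Qed.

Lemma pseudometric_shunts h m d :
  (forall k, (k < m)%N -> 0 <= h k) -> pseudometric d -> pseudometric (shunts h m d).
Proof.
move=> h0 dpm; elim: m h0 => //= m IHm h0; apply: pseudometric_shunt; first exact: h0.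
by apply: IHm => k km; apply: h0; lia.
Qed.

Lemma shunts_le h m d j k : shunts h m d j k <= d j k.
Proof. elim: m => //= m IHm; exact: le_trans (shunt_le _ _ _ _ _ _) IHm. Qed.

Lemma shunts_le_weight h m d k : (forall i, (i < m)%N -> 0 <= h i) ->
  pseudometric d -> (k < m)%N -> shunts h m d k k.+1 <= h k.
Proof.
move=> h0 dpm; elim: m h0 => //= m IHm h0; rewrite ltnS leq_eqVlt => /orP[/eqP ->|km].
  apply: shunt_le_weight; apply: pseudometric_shunts => // i im; apply: h0; lia.
apply: le_trans (shunt_le _ _ _ _ _ _) (IHm _ km) => i im; apply: h0; lia.
Qed.

Lemma reach_spikes v m d : (forall k, (k < m)%N -> 0 <= v k) ->
  reach [seq k.*2 | k <- iota 0 m] d (spikes v m d).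
Proof.
elim: m => [//|m IHm] v0.
have -> : iota 0 m.+1 = iota 0 m ++ [:: m] by rewrite -addn1 iotaD.
rewrite map_cat; apply/reach_cat; exists (spikes v m d).
  by apply: IHm => k km; apply: v0; lia.
by exists (v m); [apply: v0|rewrite /= /op odd_double doubleK].
Qed.

Lemma reach_shunts h m d : (forall k, (k < m)%N -> 0 <= h k) ->
  reach [seq k.*2.+1 | k <- iota 0 m] d (shunts h m d).
Proof.
elim: m => [//|m IHm] h0.
have -> : iota 0 m.+1 = iota 0 m ++ [:: m] by rewrite -addn1 iotaD.
rewrite map_cat; apply/reach_cat; exists (shunts h m d).
  by apply: IHm => k km; apply: h0; lia.
by exists (h m); [apply: h0|rewrite /= /op /= odd_double /= uphalf_double].
Qed.

(** [N] bounds the letters, not the length of the word, which may grow with the depth of the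
    grid. *)
Definition reachable N d e := exists2 w, all (fun g => g < N)%N w & reach w d e.

Lemma reachable_trans N d e f : reachable N d e -> reachable N e f -> reachable N d f.
Proof.
move=> [w1 a1 r1] [w2 a2 r2]; exists (w1 ++ w2); first by rewrite all_cat a1.
by apply/reach_cat; exists e.
Qed.

Lemma reachable_rowop n v h d :
  (forall k, (k <= n)%N -> 0 <= v k) -> (forall k, (k < n)%N -> 0 <= h k) ->
  reachable n.*2.+1 d (rowop n v h d).
Proof.
move=> v0 h0; apply: (@reachable_trans _ _ (spikes v n.+1 d)).
  exists [seq k.*2 | k <- iota 0 n.+1]; last exact: reach_spikes.
  by apply/allP => _ /mapP[k kn ->]; rewrite mem_iota in kn; lia.
exists [seq k.*2.+1 | k <- iota 0 n]; last exact: reach_shunts.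
by apply/allP => _ /mapP[k kn ->]; rewrite mem_iota in kn; lia.
Qed.

Lemma spikes_delta i a m d :
  spikes (fun k => if k == i then a else 0) m d = if (i < m)%N then spike i a d else d.
Proof.
elim: m => //= m ->; case: (eqVneq m i) => [<-|mi]; first by rewrite ltnn leqnn.
by rewrite spike0 ltnS [in RHS]leq_eqVlt eq_sym (negPf mi).
Qed.

(** The weight [d k k.+1] is neutral even after the shunt at [i], because shunts only decrease
    distances. *)
Lemma shunts_delta i a m d : pseudometric d -> 0 <= a ->
  shunts (fun k => if k == i then a else d k k.+1) m d =
  if (i < m)%N then shunt i i.+1 a d else d.
Proof.
move=> dpm a0; elim: m => //= m ->; case: (eqVneq m i) => [<-|mi].
  by rewrite ltnn leqnn.
rewrite ltnS [in RHS]leq_eqVlt eq_sym (negPf mi) /=; case: ifP => _.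
  by rewrite shunt_id //; [exact: pseudometric_shunt|exact: shunt_le].
by rewrite shunt_id.
Qed.

Lemma op_rowop n g a d : 0 <= a -> pseudometric d -> (g < n.*2.+1)%N ->
  exists v h, [/\ forall k, 0 <= v k, forall k, 0 <= h k & op g a d = rowop n v h d].
Proof.
move=> a0 dpm gn; rewrite /rowop /op; have [og|og] := boolP (odd g).
  (* The redundant conditional puts the zero spikes in the form expected by [spikes_delta]. *)
  exists (fun k => if k == 0%N then 0 else 0), (fun k => if k == g./2 then a else d k k.+1).
  split=> [k|k|]; [by rewrite if_same|by case: ifP => // _; exact: pseudometric_ge0|].
  rewrite spikes_delta spike0 ?if_same shunts_delta //.
  have -> // : (g./2 < n)%N by lia.
pose e := spike g./2 a d; have epm : pseudometric e by apply: pseudometric_spike.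
(* The exceptional index [n] lies beyond the last shunt, so [shunts_delta] makes every shunt
   neutral. *)
exists (fun k => if k == g./2 then a else 0), (fun k => if k == n then 0 else e k k.+1).
split=> [k|k|]; [by case: ifP|by case: ifP => // _; exact: pseudometric_ge0|].
rewrite spikes_delta; have -> : (g./2 < n.+1)%N by lia.
by rewrite shunts_delta // ltnn.
Qed.

End Rows.

(** * Distances in a grid, computed row by row from the bottom *)

Section Grid.
Variables (R : realFieldType) (l n : nat) (G : weighted_grid R l.+1 n.+1).
Implicit Types (x y u : grid_vertex l.+1 n.+1) (c : R) (d : nat -> nat -> R).

(* [inord] sends out-of-range indices to 0: [vtx r k] is meaningful only for
   [r <= l] and [k <= n]. *)
Definition vtx r k : grid_vertex l.+1 n.+1 := (inord r, inord k).

Definition hweight r k := G (vtx r k) (vtx r k.+1).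

Definition vweight r k := G (vtx r k) (vtx r.+1 k).

(** Unlike [grid_path], a walk may repeat vertices, so walks can be concatenated freely. *)
Inductive walk r u : grid_vertex l.+1 n.+1 -> R -> Prop :=
| walk_nil : (r <= u.1)%N -> walk r u u 0
| walk_rcons x y c : walk r u x c -> grid_adj x y -> (r <= y.1)%N ->
    walk r u y (c + G x y).

(** The two halves together make [d] the distance within the rows of index at least [r]. *)
Definition rowdist r d :=
  (forall i j, (i <= n)%N -> (j <= n)%N ->
     exists2 c, walk r (vtx r i) (vtx r j) c & c <= d i j) /\
  (forall i j c, (i <= n)%N -> (j <= n)%N -> walk r (vtx r i) (vtx r j) c -> d i j <= c).

Lemma walk_row r u x c : walk r u x c -> (r <= x.1)%N.
Proof. by case. Qed.

Lemma walk_start r u x c : walk r u x c -> (r <= u.1)%N.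
Proof. by elim. Qed.

Lemma walk_cat r u x y c c' : walk r u x c -> walk r x y c' -> walk r u y (c + c').
Proof.
move=> ux; elim=> [_|y' z b _ IH yz rz]; first by rewrite addr0.
by rewrite addrA; apply: walk_rcons.
Qed.

Lemma walk_weaken r r' u x c : (r' <= r)%N -> walk r u x c -> walk r' u x c.
Proof.
move=> rr; elim=> [?|y z b _ IH yz rz]; first by apply: walk_nil; lia.
by apply: walk_rcons => //; lia.
Qed.

Lemma vtx1 r k : (r <= l)%N -> (vtx r k).1 = r :> nat.
Proof. by move=> rl; rewrite /vtx /= inordK. Qed.

Lemma vtx2 r k : (k <= n)%N -> (vtx r k).2 = k :> nat.
Proof. by move=> rl; rewrite /vtx /= inordK. Qed.

Lemma vtxK x : vtx x.1 x.2 = x.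
Proof. by case: x => i j; rewrite /vtx /= !inord_val. Qed.

Lemma adj_sym x y : grid_adj x y = grid_adj y x.
Proof.
by rewrite /grid_adj (eq_sym x.1 y.1) (eq_sym x.2 y.2); congr orb; congr andb; exact: orbC.
Qed.

Lemma adj_h r k : (k < n)%N -> grid_adj (vtx r k) (vtx r k.+1).
Proof. by move=> kn; apply/orP; left; rewrite /= eqxx !inordK ?eqxx //; lia. Qed.

Lemma adj_v r k : (r < l)%N -> grid_adj (vtx r k) (vtx r.+1 k).
Proof. by move=> rl; apply/orP; right; rewrite /= eqxx !inordK ?eqxx //; lia. Qed.

Lemma hweight_ge0 r k : (k < n)%N -> 0 <= hweight r k.
Proof. by move=> kn; apply/weight_ge0/adj_h. Qed.

Lemma vweight_ge0 r k : (r < l)%N -> 0 <= vweight r k.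
Proof. by move=> kn; apply/weight_ge0/adj_v. Qed.

Variant adj_spec : grid_vertex l.+1 n.+1 -> grid_vertex l.+1 n.+1 -> Prop :=
| AdjRight r k : (r <= l)%N -> (k < n)%N -> adj_spec (vtx r k) (vtx r k.+1)
| AdjLeft r k : (r <= l)%N -> (k < n)%N -> adj_spec (vtx r k.+1) (vtx r k)
| AdjDown r k : (r < l)%N -> (k <= n)%N -> adj_spec (vtx r k) (vtx r.+1 k)
| AdjUp r k : (r < l)%N -> (k <= n)%N -> adj_spec (vtx r.+1 k) (vtx r k).

Lemma adjP x y : grid_adj x y -> adj_spec x y.
Proof.
rewrite -{2}(vtxK x) -{2}(vtxK y) /grid_adj.
have := ltn_ord x.1; have := ltn_ord y.1; have := ltn_ord x.2; have := ltn_ord y.2.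
rewrite !ltnS => y2 x2 y1 x1 /orP[]/andP[/eqP-> /orP[]/eqP e];
  rewrite -e in x1 x2 y1 y2 *.
- exact: AdjRight.
- exact: AdjLeft.
- exact: AdjDown.
- exact: AdjUp.
Qed.

(** Induction along the walk. While it is below row [r], the invariant records the column [k] where
    it last left that row and the weight [c'] of the current excursion. *)
Lemma walk_lower_bound r d i x c :
  (r <= l)%N -> (i <= n)%N -> pseudometric d ->
  (forall k, (k < n)%N -> d k k.+1 <= hweight r k) ->
  (forall j k c, (j <= n)%N -> (k <= n)%N -> walk r.+1 (vtx r.+1 j) (vtx r.+1 k) c ->
     d j k <= vweight r j + c + vweight r k) ->
  walk r (vtx r i) x c ->
  (x.1 = r :> nat -> d i x.2 <= c) /\
  ((r < x.1)%N -> exists k c', [/\ (k <= n)%N, walk r.+1 (vtx r.+1 k) x c' &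
     d i k + vweight r k + c' <= c]).
Proof.
move=> rl il dpm dh dv; have dD j k m : d j k <= d j m + d m k by case: dpm.
elim=> [ri|{x c} x y c ix [IHr IHd] /adjP xy ry].
  split=> [_|]; first by rewrite vtx2 //; case: dpm => ->.
  by rewrite vtx1 // ltnn.
case: {x y} xy ry ix IHr IHd => s k sl kn; rewrite ?(vtx1, vtx2) //; try lia.
- move=> rs ix IHr IHd; split=> [sr|rs'].
  + subst s; have := IHr erefl; have := dh k kn; have := dD i k.+1 k; rewrite /hweight; lra.
  + have [j [c' [jn jx jc]]] := IHd rs'.
    exists j, (c' + G (vtx s k) (vtx s k.+1)); split=> //; last by lra.
    by apply: walk_rcons jx _ _; rewrite ?vtx1 //; apply: adj_h.
- move=> rs ix IHr IHd; split=> [sr|rs'].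
  + subst s; have := IHr erefl; have := dh k kn; have := dD i k k.+1.
    rewrite (pseudometricC k.+1 k dpm) /hweight weight_sym; lra.
  + have [j [c' [jn jx jc]]] := IHd rs'.
    exists j, (c' + G (vtx s k.+1) (vtx s k)); split=> //; last by lra.
    by apply: walk_rcons jx _ _; rewrite ?vtx1 // adj_sym; apply: adj_h.
- move=> rs ix IHr IHd; have := walk_row ix; rewrite (@vtx1 s k (ltnW sl)) => rs'.
  split=> [|_]; first by lia.
  case: (ltngtP r s) => [{}rs'||sr]; last 1 first.
  + subst s; exists k, 0; split=> //; first by apply: walk_nil; rewrite vtx1.
    by have := IHr erefl; rewrite /vweight; lra.
  + have [j [c' [jn jx jc]]] := IHd rs'.
    exists j, (c' + G (vtx s k) (vtx s.+1 k)); split=> //; last by lra.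
    by apply: walk_rcons jx _ _; rewrite ?vtx1 //; [apply: adj_v|lia].
  + by lia.
- move=> rs ix IHr IHd; have [j [c' [jn jx jc]]] := IHd rs; split=> [sr|rs'].
  (* The walk returns to row [r]: [dv] bounds the completed excursion. *)
  + subst s; have := dv _ _ _ jn kn jx; have := dD i k j.
    by move: jc; rewrite /vweight (weight_sym _ (vtx r.+1 k)); lra.
  + exists j, (c' + G (vtx s.+1 k) (vtx s k)); split=> //; last by lra.
    by apply: walk_rcons jx _ _; rewrite ?vtx1 //; [rewrite adj_sym; apply: adj_v|lia].
Qed.

Lemma rowdist_lower_bound r d i j c :
  (r <= l)%N -> (i <= n)%N -> (j <= n)%N -> pseudometric d ->
  (forall k, (k < n)%N -> d k k.+1 <= hweight r k) ->
  (forall j k c, (j <= n)%N -> (k <= n)%N -> walk r.+1 (vtx r.+1 j) (vtx r.+1 k) c ->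
     d j k <= vweight r j + c + vweight r k) ->
  walk r (vtx r i) (vtx r j) c -> d i j <= c.
Proof.
move=> rl il jn dpm dh dv w; have [+ _] := walk_lower_bound rl il dpm dh dv w.
by rewrite vtx1 // vtx2 //; apply.
Qed.

Definition attained r d := forall i j, (i <= n)%N -> (j <= n)%N ->
  exists2 c, walk r (vtx r i) (vtx r j) c & c <= d i j.

(** Each candidate value of a shunt is realized by splicing the horizontal edge, in either
    direction, between two walks. *)
Lemma attained_shunts r d m : (r <= l)%N -> (m <= n)%N ->
  attained r d -> attained r (shunts (hweight r) m d).
Proof.
move=> rl mn ad; elim: m mn => //= m IHm mn i j iN jN.
have := shuntP m m.+1 (hweight r m) (shunts (hweight r) m d) i j.
case=> _ _ _ [->|->|->]; first by apply: IHm => //; lia.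
- have mn' := ltnW mn; have [c1 w1 l1] := IHm mn' i m iN mn'.
  have [c2 w2 l2] := IHm mn' m.+1 j mn jN.
  exists (c1 + hweight r m + c2); last by lra.
  apply: walk_cat w2; apply: walk_rcons w1 _ _; first exact: adj_h.
  by rewrite vtx1.
- have mn' := ltnW mn; have [c1 w1 l1] := IHm mn' i m.+1 iN mn.
  have [c2 w2 l2] := IHm mn' m j mn' jN.
  exists (c1 + hweight r m + c2); last by lra.
  apply: walk_cat w2; rewrite /hweight weight_sym; apply: walk_rcons w1 _ _.
    by rewrite adj_sym adj_h.
  by rewrite vtx1.
Qed.

Lemma rowdist_rowop r d : (r < l)%N -> pseudometric d -> rowdist r.+1 d ->
  rowdist r (rowop n (vweight r) (hweight r) d).
Proof.
move=> rl dpm [ad ld]; have v0 k := vweight_ge0 k rl; have h0 k := @hweight_ge0 r k.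
have spm : pseudometric (spikes (vweight r) n.+1 d) by apply: pseudometric_spikes.
split; last first.
  move=> i j c il jn; apply: rowdist_lower_bound => //; first exact: ltnW.
  - exact: pseudometric_shunts.
  - by move=> k kn; apply: shunts_le_weight.
  move=> {i j c il jn} j k c jn kn w; apply: le_trans (shunts_le _ _ _ _ _) _.
  have := ld _ _ _ jn kn w; have := pseudometric_ge0 j k dpm; have := v0 j; have := v0 k.
  by rewrite spikesE // !ltnS jn kn; case: ifP; lra.
apply: attained_shunts => //; first exact: ltnW.
move=> i j iN jN; rewrite spikesE // !ltnS iN jN; case: eqVneq => [->|_].
  by exists 0 => //; apply: walk_nil; rewrite vtx1 // ltnW.
(* The spiked distance is realized by going down column [i], walking below and coming up column
   [j]. *)
have [c w lc] := ad i j iN jN; exists (vweight r i + c + vweight r j); last by lra.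
rewrite {2}/vweight weight_sym; apply: walk_rcons.
- apply: walk_cat (walk_weaken (leqnSn r) w); rewrite -[vweight r i]add0r.
  apply: walk_rcons; first by apply: walk_nil; rewrite vtx1 // ltnW.
    exact: adj_v.
  by rewrite vtx1.
- by rewrite adj_sym adj_v.
- by rewrite vtx1 // ltnW.
Qed.

Lemma walk_sym r u x c : walk r u x c -> walk r x u c.
Proof.
elim=> [|{x c} x y c ux IH xy ry]; first exact: walk_nil.
rewrite addrC weight_sym -[G y x]add0r; apply: walk_cat IH.
apply: walk_rcons; [exact: walk_nil|by rewrite adj_sym|exact: walk_row ux].
Qed.

Lemma walk_along r i j : (r <= l)%N -> (i <= n)%N -> (j <= n)%N ->
  exists2 c, walk r (vtx r i) (vtx r j) c & c <= \sum_(k < n) hweight r k.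
Proof.
move=> rl; wlog ij : i j / (i <= j)%N => [hw iN jN|iN jN].
  have [ij|/ltnW ji] := leqP i j; first exact: hw.
  by have [c w lc] := hw j i ji jN iN; exists c => //; apply: walk_sym.
suff [c w lc] : exists2 c, walk r (vtx r i) (vtx r j) c & c <= \sum_(k < j) hweight r k.
  exists c => //; apply: le_trans lc _; rewrite (big_ord_widen _ _ jN).
  rewrite [X in _ <= X](bigID (fun k : 'I_n => k < j)%N) /= lerDl.
  by apply: sumr_ge0 => k _; apply: hweight_ge0.
elim: j ij jN => [|j IHj].
  by rewrite leqn0 => /eqP-> _; exists 0; rewrite ?big_ord0 //; apply: walk_nil; rewrite vtx1.
rewrite leq_eqVlt => /orP[/eqP-> jN|ij jN].
  exists 0; first by apply: walk_nil; rewrite vtx1.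
  by apply: sumr_ge0 => k _; apply: hweight_ge0; have := ltn_ord k; lia.
have [c w lc] := IHj ij (ltnW jN).
exists (c + hweight r j); last by rewrite big_ord_recr /= lerD2r.
by apply: walk_rcons w _ _; [exact: adj_h|rewrite vtx1].
Qed.

Lemma rowdist_last d : pseudometric d ->
  (forall k, (k < n)%N -> d k k.+1 <= hweight l k) -> attained l d -> rowdist l d.
Proof.
move=> dpm dh ad; split=> // i j c iN jN; apply: rowdist_lower_bound => //.
(* Vacuous: such a walk would start in a row of index at least [l + 1]. *)
move=> {i j c iN jN} j k c jn kn w; have := walk_start w.
by have := ltn_ord (vtx l.+1 j).1; lia.
Qed.

(** [r] counts rows upwards from the bottom. Starting from the zero pseudometric gives every grid
    the same origin. *)
Lemma rowdist_reachable r : (r <= l)%N -> exists d,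
  [/\ rowdist (l - r) d, pseudometric d & reachable n.*2.+1 (fun _ _ => 0) d].
Proof.
have zpm : pseudometric (fun _ _ => 0 : R) by split=> *; rewrite ?addr0.
have h0 k := @hweight_ge0 l k.
elim: r => [_|r IHr rl].
  (* Spikes of weight [S], the total weight of the last row, put distinct columns [S + S] apart, too
     far to undercut the distances along that row. *)
  rewrite subn0; pose S := \sum_(k < n) hweight l k.
  have S0 : 0 <= S by apply: sumr_ge0 => k _; apply: hweight_ge0.
  have spm : pseudometric (spikes (fun _ => S) n.+1 (fun _ _ => 0)).
    exact: pseudometric_spikes.
  exists (rowop n (fun=> S) (hweight l) (fun _ _ => 0)); split.
  - apply: rowdist_last.
    + exact: pseudometric_shunts.
    + by move=> k kn; apply: shunts_le_weight.
    apply: attained_shunts => // i j iN jN; rewrite spikesE // !ltnS iN jN.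
    case: eqVneq => [->|_]; first by exists 0 => //; apply: walk_nil; rewrite vtx1.
    have [c w lc] := walk_along (leqnn l) iN jN.
    by exists c => //; rewrite add0r; apply: le_trans lc _; rewrite lerDl.
  - exact: pseudometric_shunts.
  - exact: reachable_rowop.
have [d [rd dpm zd]] := IHr (ltnW rl).
have rl' : (l - r.+1 < l)%N by lia.
have rE : (l - r = (l - r.+1).+1)%N by lia.
rewrite rE in rd; exists (rowop n (vweight (l - r.+1)) (hweight (l - r.+1)) d); split.
- exact: rowdist_rowop.
- apply: pseudometric_shunts => [k kn|]; first exact: hweight_ge0.
  by apply: pseudometric_spikes => // k; apply: vweight_ge0.
- apply: reachable_trans zd _; apply: reachable_rowop => k kn.
    exact: vweight_ge0.
  exact: hweight_ge0.
Qed.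

(** * From walks to paths without repeated vertices *)

Lemma path_weight_cons u x p : path_weight G u (x :: p) = G u x + path_weight G x p.
Proof. by rewrite /path_weight /= big_cons. Qed.

Lemma path_weight_cat u p q :
  path_weight G u (p ++ q) = path_weight G u p + path_weight G (last u p) q.
Proof.
elim: p u => [|x p IHp] u /=; first by rewrite {2}/path_weight big_nil add0r.
by rewrite !path_weight_cons IHp addrA.
Qed.

Lemma path_weight_ge0 u p : path (@grid_adj l.+1 n.+1) u p -> 0 <= path_weight G u p.
Proof.
elim: p u => [|x p IHp] u /=; first by rewrite /path_weight big_nil.
by case/andP=> ux /IHp; rewrite path_weight_cons; have := weight_ge0 G ux; lra.
Qed.

Lemma walk_path u p : path (@grid_adj l.+1 n.+1) u p -> walk 0 u (last u p) (path_weight G u p).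
Proof.
elim/last_ind: p => [_|p x IHp]; first by rewrite /path_weight big_nil; apply: walk_nil.
rewrite rcons_path last_rcons -cats1 path_weight_cat path_weight_cons.
rewrite [path_weight G x [::]]/path_weight big_nil addr0 => /andP[/IHp w px].
exact: walk_rcons w px _.
Qed.

(** When the walk revisits a vertex of the path, the loop is cut out; its weight is non-negative. *)
Lemma path_walk u x c : walk 0 u x c ->
  exists2 p, grid_path u x p & path_weight G u p <= c.
Proof.
elim=> [_|{x c} x y c _ [p] /and3P[pp up /eqP px] pc xy _].
  by exists [::]; rewrite /grid_path /= ?eqxx // /path_weight big_nil.
have [yp|yp] := boolP (y \in u :: p).
  case/splitPl: yp pp up px pc => p1 p2 py.
  rewrite cat_path => /andP[pp1 pp2] up _; rewrite path_weight_cat => pc.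
  exists p1.
    rewrite /grid_path pp1 py eqxx andbT.
    by move: up; rewrite -cat_cons cat_uniq => /and3P[].
  by have := path_weight_ge0 pp2; have := weight_ge0 G xy; lra.
exists (rcons p y).
  by rewrite /grid_path rcons_path pp px xy last_rcons eqxx -rcons_cons rcons_uniq yp up.
rewrite -cats1 path_weight_cat px path_weight_cons [path_weight G y [::]]/path_weight big_nil.
by rewrite addr0 lerD2r.
Qed.

Lemma rowdist_is_dist d (i j : 'I_n.+1) : rowdist 0 d ->
  is_dist G (first_row l i) (first_row l j) (d i j).
Proof.
have vE k : vtx 0 (k : 'I_n.+1) = first_row l k.
  by rewrite /vtx /first_row inord_val; congr pair; apply: val_inj; rewrite /= inordK.
have kn (k : 'I_n.+1) : (k <= n)%N by rewrite -ltnS.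
move=> [ad ld]; have lp p : grid_path (first_row l i) (first_row l j) p ->
    d i j <= path_weight G (first_row l i) p.
  by case/and3P=> pp _ /eqP pj; apply: ld => //; rewrite !vE -pj; apply: walk_path.
split=> //; have [c w dc] := ad i j (kn i) (kn j).
rewrite !vE in w; have [p gp pc] := path_walk w; exists p => //.
by apply/eqP; rewrite eq_le lp // andbT; apply: le_trans dc.
Qed.

End Grid.

(** * A grid with prescribed weights *)

Section Synthesis.
Variables (R : realFieldType) (l n : nat) (V H : nat -> nat -> R).
Hypothesis V_ge0 : forall r k, 0 <= V r k.
Hypothesis H_ge0 : forall r k, 0 <= H r k.

(** The minima recover the left or upper end of an edge, which indexes its weight, symmetrically in
    [x] and [y]. *)
Definition row_weight (x y : grid_vertex l.+1 n.+1) : R :=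
  if x.1 == y.1 then H x.1 (minn x.2 y.2) else V (minn x.1 y.1) (minn x.2 y.2).

Lemma row_weight_sym x y : row_weight x y = row_weight y x.
Proof.
rewrite /row_weight eq_sym (minnC x.1) (minnC x.2).
by case: eqP => [->|].
Qed.

Lemma row_weight_ge0 x y : grid_adj x y -> 0 <= row_weight x y.
Proof. by move=> _; rewrite /row_weight; case: ifP. Qed.

Definition row_grid := WeightedGrid row_weight_sym row_weight_ge0.

Lemma hweight_row_grid r k : (r <= l)%N -> (k < n)%N -> hweight row_grid r k = H r k.
Proof.
move=> rl kn; rewrite /hweight /= /row_weight eqxx vtx1 // !vtx2 //; last by lia.
by rewrite (minn_idPl _).
Qed.

Lemma vweight_row_grid r k : (r < l)%N -> (k <= n)%N -> vweight row_grid r k = V r k.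
Proof.
move=> rl kn; rewrite /vweight /= /row_weight -val_eqE /= -/(vtx l n r k).1.
rewrite !inordK; try lia.
by rewrite ltn_eqF // minnn (minn_idPl _).
Qed.
End Synthesis.

(** * From words back to grids, and the bound on the depth *)

Lemma eq_rowop (R : realFieldType) n (v h v' h' : nat -> R) d :
  (forall k, (k <= n)%N -> v k = v' k) -> (forall k, (k < n)%N -> h k = h' k) ->
  rowop n v h d = rowop n v' h' d.
Proof.
move=> vv hh; rewrite /rowop.
have {vv}eq_spikes m : (m <= n.+1)%N -> spikes v m d = spikes v' m d.
  by elim: m => //= m IHm mn; rewrite vv // IHm // ltnW.
have {hh}eq_shunts m e : (m <= n)%N -> shunts h m e = shunts h' m e.
  by elim: m => //= m IHm mn; rewrite hh // IHm // ltnW.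
by rewrite eq_spikes // eq_shunts.
Qed.

Lemma all_staircase k N : (k <= N)%N -> all (fun g => g < N)%N (staircase k).
Proof.
have all_descent m : (m <= N)%N -> all (fun g => g < N)%N (descent m).
  by elim: m => //= m IHm mN; rewrite mN IHm // ltnW.
elim: k => // k IHk kN; rewrite [staircase _]/= all_cat IHk ?(ltnW kN) //.
exact: (all_descent k.+1).
Qed.

(** [D r] is the pseudometric at row [r]. As the head of a word is the lowest row, induction on the
    last letter adds a row on top and shifts the others down by one. *)
Lemma reach_rows (R : realFieldType) n w (d e : nat -> nat -> R) :
  pseudometric d -> all (fun g => g < n.*2.+1)%N w -> reach w d e ->
  exists V H D, [/\ forall r k, 0 <= V r k, forall r k, 0 <= H r k,
    forall k, H (size w) k = 0, D 0%N = e /\ D (size w) = d &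
    forall r, (r < size w)%N -> pseudometric (D r.+1) /\ D r = rowop n (V r) (H r) (D r.+1)].
Proof.
move=> dpm; elim/last_ind: w e => [|w g IHw] e.
  by move=> _ /= ->; exists (fun _ _ => 0), (fun _ _ => 0), (fun _ => d).
rewrite all_rcons => /andP[gn /IHw{}IHw]; rewrite -cats1 => /reach_cat[f wf] /= [a a0 ->].
have fpm := pseudometric_reach dpm wf.
have [V [H [D [V0 H0 Hw [D0 Dw] Dr]]]] := IHw f wf.
have [v [h [v0 h0 ->]]] := op_rowop a0 fpm gn.
rewrite cats1 size_rcons.
exists (fun r => if r is r'.+1 then V r' else v), (fun r => if r is r'.+1 then H r' else h),
  (fun r => if r is r'.+1 then D r' else rowop n v h f).
split=> //; [by case|by case|].
by case=> [_|r]; [rewrite D0|exact: Dr].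
Qed.

Theorem lemma9 (R : realFieldType) (omega : nat) (omega_gt1 : (1 < omega)%N)
    (l : nat) (G : weighted_grid R l.+1 omega) :
  exists (l' : nat) (G' : weighted_grid R l'.+1 omega),
    (l'.+1%:R <= omega%:R ^+ 5 / 4 :> R) /\
    forall i j : 'I_omega, (i <= j)%N ->
      exists d : R,
        is_dist G (first_row l i) (first_row l j) d /\
        is_dist G' (first_row l' i) (first_row l' j) d.
Proof.
case: omega omega_gt1 G => [//|n] n1 G.
have [d [dG _ [w wn zd]]] := rowdist_reachable G (leqnn l).
rewrite subnn in dG.
pose z (_ _ : nat) : R := 0; have zpm : pseudometric z by split=> *; rewrite ?addr0.
(* The word read off [G] is replaced by the staircase, with the same zero start and the same final
   [d]. *)
have zs := subword_staircase wn zpm zd.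
have : all (fun g => g < n.*2.+1)%N (staircase n.*2.+1) by exact: all_staircase.
move: (size_staircase n.*2.+1) zs; move: (staircase _) => {wn zd}w sw zs wn.
have [V [H [D [V0 H0 Hw [D0 Dw] Dr]]]] := reach_rows zpm wn zs.
exists (size w), (row_grid (size w) n V0 H0); split.
  rewrite ler_pdivlMr // -natrX -natrM ler_nat sw.
  have -> : 'C(n.*2.+2, 2) = (n.+1 * n.*2.+1)%N by rewrite bin2 -doubleS -doubleMl doubleK.
  have -> : (n.+1 ^ 5 = n.+1 ^ 2 * n.+1 ^ 3)%N by rewrite -expnD.
  (* With [m = n + 1 >= 2], four times the depth is [8 m^2 - 4 m + 4 <= 8 m^2 <= m^5]. *)
  have : (2 ^ 3 <= n.+1 ^ 3)%N by rewrite leq_exp2r.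
  by rewrite -mulnn; nia.
(* Upward induction: [D] gives the row distances of the new grid. In the last row both the weights
   and [D] vanish. *)
have rd r : (r <= size w)%N -> rowdist (row_grid (size w) n V0 H0) (size w - r) (D (size w - r)%N).
  elim: r => [_|r IHr rw].
    rewrite subn0 Dw; apply: rowdist_last => // [k kn|i j iN jN].
      by rewrite hweight_row_grid // Hw.
    have [c wc lc] := walk_along (row_grid (size w) n V0 H0) (leqnn _) iN jN.
    exists c => //; apply: le_trans lc _; rewrite big1 // => k _.
    by rewrite hweight_row_grid ?Hw.
  have rw' : (size w - r.+1 < size w)%N by lia.
  have rE : (size w - r = (size w - r.+1).+1)%N by lia.
  have [Dpm ->] := Dr _ rw'; have := IHr (ltnW rw); rewrite rE => Dd.
  have -> // : rowop n (V (size w - r.+1)%N) (H (size w - r.+1)%N) (D (size w - r.+1).+1) =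
    rowop n (vweight (row_grid (size w) n V0 H0) (size w - r.+1))
      (hweight (row_grid (size w) n V0 H0) (size w - r.+1)) (D (size w - r.+1).+1).
    by apply: eq_rowop => k kn; rewrite ?vweight_row_grid ?hweight_row_grid // ltnW.
  exact: rowdist_rowop.
move=> i j _; exists (d i j); split; first exact: rowdist_is_dist.
by apply: rowdist_is_dist; have := rd _ (leqnn _); rewrite subnn D0.
Qed.
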